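(* Fix an integer $\ell\ge 2$, and put $a=\lfloor \ell/2\rfloor$, $b=\lceil \ell/2\rceil$, and $q=b+3$. Start with a clique $Q=K_q$ containing distinct vertices $u,v,w$. Attach $a$ leaves (new degree-one vertices) to each of $u$ and $v$, and attach $b$ leaves to $w$. Call the resulting graph $X_\ell$, and let $Y_\ell=X_\ell-uv$ be the graph obtained by deleting the edge $uv$. Then both $X_\ell$ and $Y_\ell$ are connected, have order $2\ell+3$, and satisfy \[ Z^+_{(\ell)}(X_\ell)=2\ell+2, \qquad Z^+_{(\ell)}(Y_\ell)=2\ell . \] Thus, for every $\ell\ge2$, $Z^+_{(\ell)}(X_\ell)-Z^+_{(\ell)}(X_\ell-uv)=2$.
   Context: All graphs are finite and simple; the order of a graph is its number of vertices. PSD color-change rule on a graph $X$: let $B\subseteq V(X)$ be the current set of blue vertices (all others are white), and let $C$ be the vertex set of a connected component of $X-B$. A blue vertex $x\in B$ may PSD-force a vertex $y\in C$ (turn $y$ blue) when $N_X(x)\cap C=\{y\}$. Forces are applied one after another, recomputing the components of the white graph after each force. A leak is a vertex that is forbidden to perform a force. A set $B\subseteq V(X)$ is an $\ell$-leaky PSD forcing set of $X$ if, for every set $L\subseteq V(X)$ of exactly $\ell$ leaks, starting from the initial blue set $B$ there is a sequence of PSD forces, none performed by a vertex of $L$, after which all vertices of $X$ are blue. $Z^+_{(\ell)}(X)$ denotes the minimum size of an $\ell$-leaky PSD forcing set of $X$, where $0\le\ell\le|V(X)|$. *)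

(* Defs.v *)
From mathcomp Require Import all_boot.

Set Implicit Arguments.
Unset Strict Implicit.
Unset Printing Implicit Defensive.

Record sgraph := SGraph {
  vert :> finType;
  edge : rel vert;
  edge_sym : symmetric edge;
  edge_irr : irreflexive edge }.

Arguments edge {s} : rename.

Definition neighbours (G : sgraph) (x : G) : {set G} := [set y | edge x y].

Definition connected_graph (G : sgraph) : Prop :=
  0 < #|G| /\ forall x y : G, connect edge x y.

Section Constructions.

Definition complete_rel n : rel 'I_n := [rel x y | x != y].

Lemma complete_sym n : symmetric (@complete_rel n).
Proof. by move=> x y; rewrite /complete_rel /= eq_sym. Qed.

Lemma complete_irr n : irreflexive (@complete_rel n).
Proof. by move=> x; rewrite /complete_rel /= eqxx. Qed.

Definition complete n : sgraph := SGraph (@complete_sym n) (@complete_irr n).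

Variable G : sgraph.

(* [c x] leaves are attached to each vertex x of G: the new vertices are the
   pairs t = (x, i) with i < c x, and the only neighbour of t is [tag t] = x. *)
Definition leaves_rel (c : G -> nat) : rel (G + {x : G & 'I_(c x)}) :=
  fun p q => match p, q with
  | inl x, inl y => edge x y
  | inl x, inr t => x == tag t
  | inr t, inl x => x == tag t
  | inr _, inr _ => false
  end.

Lemma leaves_sym c : symmetric (@leaves_rel c).
Proof. by case=> [x|s] [y|t] //=; exact: edge_sym. Qed.

Lemma leaves_irr c : irreflexive (@leaves_rel c).
Proof. by case=> [x|s] //=; exact: edge_irr. Qed.

Definition attach_leaves (c : G -> nat) : sgraph :=
  SGraph (@leaves_sym c) (@leaves_irr c).

Definition del_edge_rel (u v : G) : rel G :=
  [rel x y | edge x y && ([set x; y] != [set u; v])].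

Lemma del_edge_sym u v : symmetric (del_edge_rel u v).
Proof. by move=> x y; rewrite /del_edge_rel /= edge_sym setUC. Qed.

Lemma del_edge_irr u v : irreflexive (del_edge_rel u v).
Proof. by move=> x; rewrite /del_edge_rel /= edge_irr. Qed.

Definition del_edge (u v : G) : sgraph :=
  SGraph (@del_edge_sym u v) (@del_edge_irr u v).

End Constructions.

Section PSDForcing.
Variable G : sgraph.
Implicit Types B L C : {set G}.

Definition white_rel B : rel G :=
  [rel x y | [&& x \notin B, y \notin B & edge x y]].

(* The vertex sets of the connected components of G - B. *)
Definition white_components B : {set {set G}} :=
  [set [set y | connect (white_rel B) x y] | x in ~: B].

Definition psd_force B (x y : G) : bool :=
  (x \in B) && [exists C in white_components B, neighbours x :&: C == [set y]].

Definition psd_step L : rel {set G} :=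
  [rel B B' | [exists x in ~: L, exists y, psd_force B x y && (B' == y |: B)]].

Definition leaky_psd_forcing (l : nat) B : bool :=
  [forall L : {set G}, (#|L| == l) ==> connect (psd_step L) B [set: G]].

(* The full vertex set is l-leaky PSD forcing for every l, so the minimum below
   is always attained; it is meant for l <= #|G|. *)
Lemma leaky_psd_forcingT l : leaky_psd_forcing l [set: G].
Proof. by apply/forallP=> L; apply/implyP. Qed.

Definition Zplus_leaky (l : nat) : nat :=
  #|[arg min_(B < [set: G] | leaky_psd_forcing l B) #|B|]|.

Lemma Zplus_leakyP l :
  (exists2 B, leaky_psd_forcing l B & #|B| = Zplus_leaky l) /\
  (forall B, leaky_psd_forcing l B -> Zplus_leaky l <= #|B|).
Proof.
rewrite /Zplus_leaky; case: arg_minnP => [|B lB minB].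
  exact: leaky_psd_forcingT.
by split=> //; exists B.
Qed.

End PSDForcing.

(* l./2 and uphalf l are the floor and the ceiling of l / 2. *)
Definition leaf_count l (u v w x : complete (uphalf l + 3)) : nat :=
  if (x == u) || (x == v) then l./2 else if x == w then uphalf l else 0.

Definition graphX l (u v w : complete (uphalf l + 3)) : sgraph :=
  attach_leaves (leaf_count u v w).

Definition graphY l (u v w : complete (uphalf l + 3)) : sgraph :=
  @del_edge (graphX u v w) (inl u) (inl v).

(* Main.v *)
(* Call the forcers of a set F of vertices those vertices that could PSD-force
   into F if exactly the vertices of F were white.  A set B is l-leaky PSD
   forcing iff every nonempty set F of initially white vertices has more than l
   forcers: otherwise the leaks can cover the forcers of F and F stays white
   forever.  Hence a white leaf is never allowed.  In X two vertices of the
   clique are adjacent twins up to their leaves, so the pair has at most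
   a + b = l forcers, and at most one vertex can be white.  In Y the edge uv no
   longer exists, and all nonempty subsets of {u, v, w} have at least l + 1
   forcers, while a fourth clique vertex z, together with any white vertex other
   than w, has at most max(a + 1, 2) <= l forcers. *)
Require Import Defs.
From mathcomp Require Import all_boot.
From mathcomp Require Import zify.

Set Implicit Arguments.
Unset Strict Implicit.
Unset Printing Implicit Defensive.

Lemma superset_of_card (T : finType) (A : {set T}) n :
  #|A| <= n -> n <= #|T| -> exists2 L : {set T}, A \subset L & #|L| = n.
Proof.
move=> leAn; rewrite -(subnKC leAn); elim: (n - #|A|) => [|k IHk] ltkT.
  by exists A; rewrite ?addn0.
have [|L sAL cL] := IHk; first by lia.
have /card_gt0P[x] : 0 < #|~: L| by have := cardsC L; lia.
rewrite inE => xL; exists (x |: L); last by rewrite cardsU1 xL cL; lia.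
exact: subset_trans sAL (subsetUr _ _).
Qed.

(** * Forcers of a white set, and the criterion for leaky forcing *)

Section Forcers.
Variable G : sgraph.
Implicit Types (B F L : {set G}) (x y : G).

Definition forcers F : {set G} := [set x | [exists y, psd_force (~: F) x y]].

(** The component that witnesses a force contains [y], hence is the component of [y]. This trades
    the quantified component for connectivity from [y]. *)
Lemma psd_forceP B x y :
  reflect [/\ x \in B, y \notin B, edge x y &
             forall z, connect (white_rel B) y z -> edge x z -> z = y]
          (psd_force B x y).
Proof.
apply: (iffP andP) => [[xB /exists_inP[C /imsetP[t]]]|[xB yB exy conn]].
  rewrite inE => tB -> /eqP/setP E.
  have := E y; rewrite !inE eqxx => /andP[exy cty].
  split=> //.
    case/connectP: cty => p; case: (lastP p) => [_ -> //|{}p z].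
    by rewrite rcons_path last_rcons => /andP[_ /and3P[_ ? _]] ->.
  move=> z cyz exz; apply/eqP; have := E z.
  by rewrite !inE exz (connect_trans cty cyz) => <-.
split=> //; apply/exists_inP; exists [set z | connect (white_rel B) y z].
  by apply/imsetP; exists y; rewrite ?inE.
apply/eqP/setP=> z; rewrite !inE; apply/andP/eqP => [[exz cyz]|->].
  exact: conn.
by rewrite exy connect0.
Qed.

Lemma forcersP F x :
  reflect (exists y, [/\ x \notin F, y \in F, edge x y &
             forall z, connect (white_rel (~: F)) y z -> edge x z -> z = y])
          (x \in forcers F).
Proof.
rewrite inE; apply: (iffP existsP) => -[y]; last first.
  by case=> xF yF exy h; exists y; apply/psd_forceP; rewrite !inE negbK.
by case/psd_forceP; rewrite !inE negbK => xF yF exy h; exists y.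
Qed.

(** Shrinking the white set to [F] only shrinks the component of [y], so [y] remains the sole
    neighbour of [x] in it. *)
Lemma psd_force_forcers B F x y :
  F \subset ~: B -> psd_force B x y -> y \in F -> x \in forcers F.
Proof.
move=> sFB /psd_forceP[xB _ exy h] yF.
have inB z : z \in F -> z \notin B by move/(subsetP sFB); rewrite inE.
apply/forcersP; exists y; split=> //; first by apply: contraL xB => /inB.
move=> z cyz; apply: h; apply: connect_sub cyz => s t.
rewrite /white_rel /= !inE !negbK => /and3P[/inB sB /inB tB est].
by rewrite connect1 //= sB tB.
Qed.

(** Reduces both values of the theorem to counting forcers. The bound on [l] guarantees that few
    forcers can be padded to a leak set of exactly [l] vertices. *)
Lemma leaky_psd_forcingP l B : l <= #|G| ->
  reflect (forall F, F \subset ~: B -> F != set0 -> l < #|forcers F|)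
          (leaky_psd_forcing l B).
Proof.
move=> lG; apply: (iffP forallP) => [lB F sFB Fn0|h L].
  rewrite ltnNge; apply/negP => cF.
  have [L sFL cL] := superset_of_card cF lG.
  have /connectP[p] := implyP (lB L) (introT eqP cL).
  (* Invariant along the sequence of forces: [F] stays white. A force into [F] would be performed by
     a forcer of [F], and all of these are leaks. *)
  elim: p B sFB {lB} => [|B' p IHp] B sFB /=.
    by move=> _ BT; move: sFB Fn0; rewrite -BT setCT subset0 => ->.
  case/andP=> /exists_inP[x xL /existsP[y /andP[xy /eqP->]]].
  apply: IHp; apply/subsetP=> z zF; rewrite !inE negb_or.
  move/(subsetP sFB): (zF); rewrite inE => ->; rewrite andbT.
  apply: contraL xL => /eqP zy; rewrite inE negbK (subsetP sFL) //.
  by apply: psd_force_forcers sFB xy _; rewrite -zy.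
(* Conversely, induct on a bound [n] for the number of white vertices. Applied to the whole white
   set, the hypothesis yields a forcer that is not a leak, and it passes to the smaller white set
   after the force. *)
apply/implyP=> /eqP cL; move: {2}#|~: B| (leqnn #|~: B|) => n.
elim: n B h => [|n IHn] B h cB.
  rewrite (_ : B = [set: G]) ?connect0 //; apply/setP=> x.
  by move: cB; rewrite leqn0 cards_eq0 => /eqP/setP/(_ x); rewrite !inE => /negbFE.
have [B0|Bn0] := eqVneq (~: B) set0.
  by apply: IHn => //; rewrite B0 cards0.
have : ~~ (forcers (~: B) \subset L).
  by apply/negP=> /subset_leq_card; rewrite cL leqNgt h.
case/subsetPn=> x; rewrite inE setCK => /existsP[y xy] xL.
apply: (@connect_trans _ _ (y |: B)).
  apply: connect1; apply/exists_inP; exists x; first by rewrite inE.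
  by apply/existsP; exists y; rewrite xy eqxx.
have yB : y \notin B by case/psd_forceP: xy.
apply: IHn => [F sF|]; first by apply: h; apply: subset_trans sF _; rewrite setCS subsetUr.
have := cardsC B; have := cardsC (y |: B); rewrite cardsU1 yB.
by move: cB; lia.
Qed.

Lemma private_forcers F x y :
  y \in F -> x \notin F -> edge x y ->
  (forall z, z \in F -> edge x z -> z = y) -> x \in forcers F.
Proof.
move=> yF xF exy h; apply/forcersP; exists y; split=> // z /connectP[p].
case: (lastP p) => [_ -> //|{}p t].
rewrite rcons_path last_rcons => /andP[_ /and3P[_ tF _]] ->.
by apply: h; move: tF; rewrite inE negbK.
Qed.

(** The component of [y] in the white graph is then [y] alone, so each neighbour may force it. *)
Lemma isolated_forcers F y :
  y \in F -> (forall z, z \in F -> ~~ edge y z) -> neighbours y \subset forcers F.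
Proof.
move=> yF iso; apply/subsetP=> x; rewrite inE => eyx; apply/forcersP; exists y.
split; rewrite 1?edge_sym //; first by apply: contraL eyx => /iso.
move=> z /connectP[[|t p] /=]; first by move=> _ ->.
by rewrite /white_rel /= !inE !negbK => /andP[/and3P[_ /iso/negbTE->]].
Qed.

Lemma forcers1 y : forcers [set y] \subset neighbours y.
Proof.
by apply/subsetP=> x /forcersP[z [_ /set1P-> exy _]]; rewrite inE edge_sym.
Qed.

(** Adjacent white vertices share a component, so a common neighbour of both is blocked. *)
Lemma forcers2 x y p : edge x y -> p \in forcers [set x; y] ->
  [&& p != x, p != y & edge p x (+) edge p y].
Proof.
move=> exy; have xy : x != y by apply: contraTneq exy => ->; rewrite edge_irr.
case/forcersP=> t [+ + ept h].
rewrite !inE negb_or => /andP[-> ->] /= /orP[] /eqP tE; subst t; rewrite ept.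
  apply/negP=> epy; suff yx : y = x by rewrite yx eqxx in xy.
  by apply: h => //; apply: connect1; rewrite /white_rel /= !inE !eqxx ?orbT exy.
rewrite addbT; apply/negP=> epx; suff yx : x = y by rewrite yx eqxx in xy.
by apply: h => //; apply: connect1; rewrite /white_rel /= !inE !eqxx ?orbT edge_sym exy.
Qed.

Lemma Zplus_leaky_eq l B : leaky_psd_forcing l B ->
  (forall B', leaky_psd_forcing l B' -> #|B| <= #|B'|) ->
  Zplus_leaky G l = #|B|.
Proof.
move=> lB minB; have [[B0 lB0 <-] min] := Zplus_leakyP G l.
by apply/eqP; rewrite eqn_leq min ?minB.
Qed.

End Forcers.

(** * Counting attached leaves *)

Section Leaves.
Variables (H : sgraph) (c : H -> nat).

Definition leaves_at (x : H) : {set attach_leaves c} :=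
  [set inr (Tagged (fun y => 'I_(c y)) i) | i : 'I_(c x)].

Lemma mem_leaves_at x (p : attach_leaves c) :
  (p \in leaves_at x) = if p is inr t then tag t == x else false.
Proof.
apply/imsetP/idP => [[i _ ->] //=|].
by case: p => // -[y i] /= /eqP yx; subst y; exists i.
Qed.

Lemma card_leaves_at x : #|leaves_at x| = c x.
Proof. by rewrite card_imset ?card_ord // => i j [] /eqP; rewrite eq_Tagged => /eqP. Qed.

Lemma card_attach_leaves : #|attach_leaves c| = #|H| + \sum_x c x.
Proof.
rewrite card_sum card_tagged sumnE big_map big_enum /=.
by congr (_ + _); apply: eq_bigr => x _; rewrite card_ord.
Qed.

End Leaves.

Lemma addn_half_uphalf n : n./2 + uphalf n = n.
Proof. by lia. Qed.

(** * Leaf counts, orders, edges and connectivity of the two graphs *)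

Section Graphs.
Variables (l : nat) (hl : 2 <= l) (u v w : complete (uphalf l + 3)).
Hypotheses (huv : u != v) (huw : u != w) (hvw : v != w).

Local Notation K := (complete (uphalf l + 3)).
Local Notation c := (leaf_count u v w).
Local Notation Xl := (graphX u v w).
Local Notation Yl := (graphY u v w).
Local Notation inK := (inl : K -> Xl).
Local Notation leaves := (@leaves_at K c).

Lemma leaf_count_u : c u = l./2.
Proof. by rewrite /leaf_count eqxx. Qed.

Lemma leaf_count_v : c v = l./2.
Proof. by rewrite /leaf_count eqxx orbT. Qed.

Lemma leaf_count_w : c w = uphalf l.
Proof. by rewrite /leaf_count eqxx ![w == _]eq_sym (negbTE huw) (negbTE hvw). Qed.

Lemma leaf_count_le_half x : x != w -> c x <= l./2.
Proof. by rewrite /leaf_count => /negbTE->; case: ifP. Qed.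

Lemma leaf_count_le_uphalf x : c x <= uphalf l.
Proof. by rewrite /leaf_count; case: ifP => _; [lia | case: ifP]. Qed.

(** Only [w] can carry more than [l./2] leaves, and at most one of [x] and [y] is [w]. *)
Lemma leaf_count_pair x y : x != y -> c x + c y <= l.
Proof.
have hx := leaf_count_le_uphalf x; have hy := leaf_count_le_uphalf y.
have [->|/leaf_count_le_half hx' _] := eqVneq x w; last by lia.
by rewrite eq_sym leaf_count_w => /leaf_count_le_half; lia.
Qed.

Lemma sum_leaf_count : \sum_x c x = l./2 + l./2 + uphalf l.
Proof.
rewrite (bigD1 u) // (bigD1 v) 1?eq_sym //= (bigD1 w) /=; last first.
  by rewrite ![w == _]eq_sym huw hvw.
rewrite big1 ?leaf_count_u ?leaf_count_v ?leaf_count_w ?addn0 ?addnA //.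
by move=> x /andP[/andP[/negbTE xu /negbTE xv] /negbTE xw]; rewrite /leaf_count xu xv xw.
Qed.

Lemma card_graphX : #|Xl| = 2 * l + 3.
Proof. by rewrite card_attach_leaves card_ord sum_leaf_count; lia. Qed.

Lemma le_card_graphX : l <= #|Xl|.
Proof. by rewrite card_graphX; lia. Qed.

Lemma card_graphY : #|Yl| = 2 * l + 3.
Proof. exact: card_graphX. Qed.

Lemma le_card_graphY : l <= #|Yl|.
Proof. by rewrite card_graphY; lia. Qed.

Lemma edgeY (p q : Xl) :
  @edge Yl p q = @edge Xl p q && ([set p; q] != [set inK u; inK v]).
Proof. by []. Qed.

Lemma edgeY_inl (x y : K) : @edge Yl (inK x) (inK y) =
  (x != y) && ~~ ((x == u) && (y == v) || (x == v) && (y == u)).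
Proof.
rewrite edgeY /=; congr (_ && ~~ _).
apply/eqP/orP => [/setP E|[]/andP[/eqP-> /eqP->] //]; last exact: setUC.
have := E (inK x); have := E (inK y); have := E (inK u); have := E (inK v).
rewrite !inE !(inj_eq inl_inj) !eqxx ?orbT /= ![v == _]eq_sym ![u == _]eq_sym.
have := huv; do 4![case: eqVneq => //= ?; subst => //=]; rewrite ?eqxx ?orbT //; auto.
Qed.

Lemma edgeY_leaf (x : K) (t : {x : K & 'I_(c x)}) :
  @edge Yl (inK x) (inr t) = (x == tag t).
Proof.
rewrite edgeY /= andb_idr // => _; apply/eqP=> /setP/(_ (inr t)).
by rewrite !inE eqxx orbT.
Qed.

(** The deleted edge avoids [w], which stays adjacent to every other clique vertex and serves as a
    hub. *)
Lemma connected_graphY : connected_graph Yl.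
Proof.
split; first by rewrite card_graphY addn3.
have cw (x : K) : @connect Yl edge (inK x) (inK w).
  have [->|xw] := eqVneq x w; first exact: connect0.
  apply: connect1; rewrite edgeY_inl xw ![w == _]eq_sym.
  by rewrite (negbTE huw) (negbTE hvw) !andbF.
have cpw (p : Yl) : @connect Yl edge p (inK w).
  case: p => [x|t]; first exact: cw.
  apply: connect_trans (cw (tag t)); apply: connect1.
  by rewrite edge_sym edgeY_leaf.
have csym : connect_sym (@edge Yl) by apply: sym_connect_sym; exact: edge_sym.
by move=> p q; apply: connect_trans (cpw p) _; rewrite csym.
Qed.

Lemma connected_graphX : connected_graph Xl.
Proof.
split; first by rewrite card_graphX addn3.
move=> p q; apply: connect_sub (connected_graphY.2 p q) => s t.
by rewrite edgeY => /andP[/connect1].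
Qed.

(** * Lower bounds: which vertices can be white initially *)

Lemma leaky_graphX_leaf (B : {set Xl}) (t : {x : K & 'I_(c x)}) :
  leaky_psd_forcing l B -> inr t \in B.
Proof.
move=> /(leaky_psd_forcingP _ le_card_graphX)/(_ [set inr t]) h.
apply: contraT => tB; have : l < #|forcers [set (inr t : Xl)]|.
  by apply: h; rewrite -?card_gt0 ?cards1 // sub1set inE.
(* A lone white leaf can be forced only by its one neighbour, and [1 < l]. *)
have /subset_leq_card : forcers [set (inr t : Xl)] \subset [set inK (tag t)].
  apply: subset_trans (forcers1 _) _; by apply/subsetP=> -[x|s]; rewrite !inE.
by rewrite cards1; lia.
Qed.

Lemma leaky_graphY_leaf (B : {set Yl}) (t : {x : K & 'I_(c x)}) :
  leaky_psd_forcing l B -> (inr t : Xl) \in B.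
Proof.
move=> /(leaky_psd_forcingP _ le_card_graphY)/(_ [set (inr t : Xl)]) h.
apply: contraT => tB; have : l < #|@forcers Yl [set (inr t : Xl)]|.
  by apply: h; rewrite -?card_gt0 ?cards1 // sub1set inE.
have /subset_leq_card : @forcers Yl [set (inr t : Xl)] \subset [set inK (tag t)].
  apply: subset_trans (forcers1 _) _; apply/subsetP=> -[x|s]; rewrite !inE.
    by rewrite edge_sym edgeY_leaf.
  by rewrite edgeY.
by rewrite cards1; lia.
Qed.

Lemma leaky_graphX_card (B : {set Xl}) :
  leaky_psd_forcing l B -> 2 * l + 2 <= #|B|.
Proof.
move=> lB; rewrite leqNgt; apply/negP => cB.
have : 1 < #|~: B| by have := cardsC B; rewrite card_graphX; lia.
case/card_gt1P=> -[x|s] [[y|t]]; rewrite !inE => -[xB yB];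
  rewrite ?leaky_graphX_leaf // in xB yB *.
rewrite (inj_eq inl_inj) => xy.
have : l < #|forcers [set inK x; inK y]|.
  apply: (leaky_psd_forcingP _ le_card_graphX) lB _ _ _.
    by apply/subsetP=> p; rewrite !inE => /orP[] /eqP->.
  by apply/set0Pn; exists (inK x); rewrite set21.
(* Every other clique vertex of [X] sees both [x] and [y], so only their leaves can force. *)
have /subset_leq_card : forcers [set inK x; inK y] \subset leaves x :|: leaves y.
  apply/subsetP=> p /forcers2 -/(_ xy); rewrite inE !mem_leaves_at.
  case: p => [z|t] /=; first by rewrite !(inj_eq inl_inj) => /and3P[zx zy]; rewrite /complete_rel /= zx zy.
  by rewrite ![_ == tag t]eq_sym; do 2!case: (tag t == _).
have := leq_card_setU (leaves x) (leaves y); rewrite !card_leaves_at.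
move=> [cU _] cF /leq_trans-/(_ _ cF)/leq_trans-/(_ _ cU).
by rewrite ltnNge leaf_count_pair.
Qed.

Lemma leaky_graphY_card (B : {set Yl}) :
  leaky_psd_forcing l B -> 2 * l <= #|B|.
Proof.
move=> lB; rewrite leqNgt; apply/negP => cB.
pose W : {set K} := [set x | inK x \notin B].
(* All leaves are blue, so [W] accounts for every white vertex, and fewer than [2 * l] of the
   [2 * l + 3] vertices are blue. *)
have cW : 3 < #|W|.
  have -> : #|W| = #|~: B|.
    rewrite -(card_imset _ (@inl_inj K {x : K & 'I_(c x)})); apply: eq_card => p.
    rewrite inE; apply/imsetP/idP => [[x + ->]|]; first by rewrite inE.
    case: p => [x|t] pB; last by rewrite leaky_graphY_leaf in pB.
    by exists x; rewrite ?inE.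
  have := cardsC B; rewrite card_graphY; lia.
have /card_gt0P[z] : 0 < #|W :\: [set u; v; w]|.
  rewrite cardsD subn_gt0; apply: leq_ltn_trans (subset_leq_card (subsetIr _ _)) _.
  by rewrite -setUA !cardsU1 cards1; lia.
have /card_gt0P[y] : 0 < #|W :\: [set z; w]|.
  rewrite cardsD subn_gt0; apply: leq_ltn_trans (subset_leq_card (subsetIr _ _)) _.
  by rewrite cards2; lia.
rewrite !inE !negb_or => /andP[/andP[yz yw] yB] /andP[/andP[/andP[zu zv] zw] zB].
have edgez (x : K) : @edge Yl (inK x) (inK z) = (x != z).
  by rewrite edgeY_inl (negbTE zu) (negbTE zv) !andbF andbT.
have cz : c z = 0 by rewrite /leaf_count (negbTE zu) (negbTE zv) (negbTE zw).
have : l < #|@forcers Yl [set inK y; inK z]|.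
  apply: (leaky_psd_forcingP _ le_card_graphY) lB _ _ _.
    by apply/subsetP=> p; rewrite !inE => /orP[] /eqP->.
  by apply/set0Pn; exists (inK y); rewrite set21.
(* Since [z] sees all of the clique and has no leaves, a forcer is a leaf at [y] or a clique vertex
   not adjacent to [y], that is, the other end of the deleted edge. When [y] is neither [u] nor [v]
   the covering set is larger than necessary, but still small enough. *)
have /subset_leq_card : @forcers Yl [set inK y; inK z] \subset
    leaves y :|: inK @: ([set u; v] :\ y).
  apply/subsetP=> -[x|t] /forcers2; rewrite edgez => /(_ yz); rewrite inE mem_leaves_at.
    rewrite edgez edgeY_inl !(inj_eq inl_inj) (mem_imset _ _ inl_inj) !inE.
    move=> /and3P[-> ->] /=.
    by do 2!case: (x == _).
  rewrite !(@edge_sym Yl (inr t)) !edgeY_leaf [y == _]eq_sym => /and3P[_ _].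
  case: (_ == y) => //=; case: eqVneq => // zt.
  have : 0 < c z by rewrite zt; exact: leq_ltn_trans (ltn_ord (tagged t)).
  by rewrite cz.
move=> le1 lt2; have := leq_trans lt2 le1.
rewrite ltnNge => /negP; apply.
apply: leq_trans (leq_card_setU _ _) _; rewrite card_leaves_at card_imset //; last exact: inl_inj.
(* The bound is [l./2 + 1] if [y] is [u] or [v], and [0 + 2] otherwise; both are at most [l] because
   [2 <= l]. *)
have := cardsD1 y [set u; v]; rewrite cards2 huv !inE.
have := leaf_count_le_half yw; rewrite /leaf_count (negbTE yw).
move: #|_ :\ y| hl; clear; case: (_ || _) => k; lia.
Qed.

(** * Upper bounds: explicit leaky forcing sets *)

Lemma card_inlU_leaves (S : {set K}) x : #|inK @: S :|: leaves x| = #|S| + c x.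
Proof.
rewrite cardsU card_imset ?card_leaves_at; last exact: inl_inj.
rewrite (_ : _ :&: _ = set0) ?cards0 ?subn0 //; apply/setP=> p.
rewrite !inE mem_leaves_at; apply/andP=> -[/imsetP[y _ ->]] //.
Qed.

Lemma leaves_forcersY (F : {set Xl}) (S : {set K}) x :
  F \subset inK @: S -> inK x \in F -> leaves x \subset @forcers Yl F.
Proof.
move=> sF xF; apply/subsetP=> -[y|t]; rewrite mem_leaves_at //= => /eqP tx.
apply: (@private_forcers Yl F (inr t) (inK x)) => //.
- by apply/negP=> /(subsetP sF)/imsetP[].
- by rewrite edge_sym edgeY_leaf tx.
move=> z /(subsetP sF)/imsetP[y _ ->]; rewrite edge_sym edgeY_leaf tx.
by move/eqP->.
Qed.

(** The leaves at [x] and [w] supply exactly [l] forcers, so one more suffices. Naming the pair [x],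
    [x'] covers both roles of [u] and [v] at once. *)
Lemma forcersY_w (F : {set Xl}) x x' :
  [set x; x'] = [set u; v] ->
  F \subset inK @: [set u; v; w] -> inK w \in F -> inK x \in F ->
  l < #|@forcers Yl F|.
Proof.
move=> E sF wF xF.
have [xx' cx cx'] : [/\ x != x', c x = l./2 & c x' = l./2].
  have := erefl #|[set x; x']|; rewrite {2}E !cards2 huv => -[xx'].
  split; first by move: xx'; case: (_ != _).
    have : x \in [set u; v] by rewrite -E set21.
    by rewrite !inE => /orP[] /eqP->; rewrite ?leaf_count_u ?leaf_count_v.
  have : x' \in [set u; v] by rewrite -E set22.
  by rewrite !inE => /orP[] /eqP->; rewrite ?leaf_count_u ?leaf_count_v.
have Ew y : y \in [set u; v] -> y != w by rewrite !inE => /orP[] /eqP->.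
have xw : x != w by apply: Ew; rewrite -E set21.
have x'w : x' != w by apply: Ew; rewrite -E set22.
(* The extra forcer: if [x'] is white, one of its leaves, which exists because [2 <= l]; if [x'] is
   blue, [x'] itself, which forces [w] because the deleted edge no longer joins it to [x]. *)
have [p pF] : exists2 p, p \in @forcers Yl F & p \notin leaves x :|: leaves w.
  have [x'F|x'F] := boolP (inK x' \in F).
    have i : 'I_(c x') by rewrite cx'; apply: (@Ordinal _ 0); rewrite half_gt0.
    exists (inr (Tagged (fun y => 'I_(c y)) i)).
      by apply: (subsetP (leaves_forcersY sF x'F)); rewrite mem_leaves_at /= eqxx.
    by rewrite inE !mem_leaves_at /= negb_or eq_sym xx' x'w.
  exists (inK x'); last by rewrite inE !mem_leaves_at.
  apply: (@private_forcers Yl F (inK x') (inK w)) => //.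
    rewrite edgeY_inl x'w ![w == _]eq_sym.
    by rewrite (negbTE huw) (negbTE hvw) !andbF.
  move=> z zF; move/(subsetP sF)/imsetP: (zF) => [y + zy]; subst z.
  rewrite -E !inE => /orP[/orP[]|] /eqP-> //; last by rewrite edge_irr.
  rewrite edgeY => /andP[_ /eqP[]]; rewrite setUC.
  by rewrite -!imset_set1 -!imsetU E.
move=> pl; have /subset_leq_card : p |: (leaves x :|: leaves w) \subset @forcers Yl F.
  by rewrite !subUset sub1set pF !(leaves_forcersY sF).
rewrite cardsU1 pl cardsU !card_leaves_at cx leaf_count_w.
rewrite (_ : _ :&: _ = set0) ?cards0.
  by rewrite subn0 addn_half_uphalf.
apply/setP=> -[y|t]; rewrite !inE !mem_leaves_at //.
by apply/andP=> -[/eqP->] /eqP xw'; rewrite xw' eqxx in xw.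
Qed.

Lemma leaky_graphY_white3 : @leaky_psd_forcing Yl l (~: (inK @: [set u; v; w])).
Proof.
apply/(leaky_psd_forcingP _ le_card_graphY) => F; rewrite setCK => sF /set0Pn[p pF].
(* The left-out degrees are those in [Y] of [w] and of [u] or [v]. The latter is exactly [l + 1],
   which explains the clique size [uphalf l + 3]. *)
have deg_w : l < (uphalf l + 3).-1 + uphalf l by lia.
have deg_uv : l < uphalf l + 3 - 2 + l./2 by lia.
have memF z : z \in F -> exists2 y, z = inK y & y \in [set u; v; w].
  by move/(subsetP sF)/imsetP=> [y yS ->]; exists y.
have wuv : (w == u) = false /\ (w == v) = false.
  by rewrite ![w == _]eq_sym (negbTE huw) (negbTE hvw).
have iso (S : {set K}) (y : K) : inK y \in F ->
    (forall z, z \in F -> ~~ @edge Yl (inK y) z) ->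
    (forall x, x \in S -> @edge Yl (inK y) (inK x)) -> l < #|S| + c y ->
    l < #|@forcers Yl F|.
  move=> yF isoF eS lt; apply: leq_trans lt _; rewrite -card_inlU_leaves.
  apply: subset_leq_card; apply: subset_trans (@isolated_forcers Yl F (inK y) yF isoF).
  apply/subsetP=> q; rewrite 2!inE => /orP[/imsetP[x xS ->]|].
    exact: eS.
  by rewrite mem_leaves_at; case: q => // t /eqP<-; rewrite edgeY_leaf.
(* Either [w] is white with [u] or [v], or [F] is just [w], or [F] lies in the nonadjacent pair [u],
   [v]. In the last two cases a white vertex is isolated and its whole neighbourhood forces. *)
have [wF|wF] := boolP (inK w \in F).
  have [uF|uF] := boolP (inK u \in F); first exact: (@forcersY_w _ u v).
  have [vF|vF] := boolP (inK v \in F); first by apply: (@forcersY_w _ v u); rewrite // setUC.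
  apply: (iso (~: [set w]) w) => //.
  - move=> z zF; have [y zy] := memF _ zF; subst z.
    by rewrite !inE => /orP[/orP[]|] /eqP yE; subst y;
       rewrite ?zF ?edge_irr // in uF vF *.
  - by move=> x; rewrite !inE edgeY_inl eq_sym !wuv.1 !wuv.2 andbT.
  by rewrite cardsC1 card_ord leaf_count_w.
have [y pE yS] := memF _ pF; subst p.
have yuv : y \in [set u; v].
  by move: yS; rewrite !inE => /orP[//|/eqP yw]; rewrite yw (negbTE wF) in pF.
apply: (iso (~: [set u; v]) y) => //.
- move=> z zF; have [x zx] := memF _ zF; subst z.
  rewrite inE => /orP[xuv|]; last first.
    by rewrite inE => /eqP xw; rewrite xw (negbTE wF) in zF.
  rewrite edgeY_inl; move: xuv yuv; rewrite !inE.
  by move=> /orP[] /eqP-> /orP[] /eqP->; rewrite !eqxx ?orbT ?andbF.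
- move=> x; rewrite edgeY_inl; move: yuv; rewrite !inE negb_or.
  move=> /orP[] /eqP-> /andP[xu xv]; rewrite eq_sym;
  by rewrite (negbTE xu) (negbTE xv) !andbF.
rewrite cardsCs setCK cards2 huv card_ord.
by move: yuv; rewrite !inE => /orP[] /eqP->; rewrite ?leaf_count_u ?leaf_count_v.
Qed.

(** The only nonempty white set is [u] alone, and all its [l + 2] neighbours can force it. *)
Lemma leaky_graphX_white1 : leaky_psd_forcing l (~: [set inK u]).
Proof.
apply/(leaky_psd_forcingP _ le_card_graphX) => F; rewrite setCK subset1.
case/orP=> [/eqP->|/eqP->]; last by rewrite eqxx.
move=> _; have : l < #|inK @: (~: [set u]) :|: leaves u|.
  by rewrite card_inlU_leaves cardsC1 card_ord leaf_count_u; lia.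
move=> lt; apply: leq_trans lt (subset_leq_card _).
apply: subset_trans (isolated_forcers (set11 _) _); last first.
  by move=> z /set1P->; rewrite edge_irr.
apply/subsetP=> q; rewrite 2!inE => /orP[/imsetP[x xS ->]|].
  by move: xS; rewrite !inE eq_sym.
by rewrite mem_leaves_at; case: q => // t tu; rewrite /= eq_sym.
Qed.

(** * The two values and their difference *)

Lemma Zplus_graphX : Zplus_leaky Xl l = 2 * l + 2.
Proof.
have cB : #|~: [set inK u]| = 2 * l + 2 by rewrite cardsC1 card_graphX addn3 addn2.
by rewrite -cB; apply: Zplus_leaky_eq leaky_graphX_white1 _ => B /leaky_graphX_card; rewrite cB.
Qed.

Lemma Zplus_graphY : Zplus_leaky Yl l = 2 * l.
Proof.
have cB : #|~: (inK @: [set u; v; w])| = 2 * l.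
  have := cardsC (inK @: [set u; v; w]); rewrite card_graphX card_imset; last exact: inl_inj.
  rewrite -setUA cardsU1 cards2 !inE negb_or huv huw hvw /=; lia.
by rewrite -cB; apply: Zplus_leaky_eq leaky_graphY_white3 _ => B /leaky_graphY_card; rewrite cB.
Qed.

End Graphs.

Theorem theorem9 (l : nat) (hl : 2 <= l) (u v w : complete (uphalf l + 3))
    (huv : u != v) (huw : u != w) (hvw : v != w) :
  [/\ connected_graph (graphX u v w) /\ connected_graph (graphY u v w),
      #|graphX u v w| = 2 * l + 3 /\ #|graphY u v w| = 2 * l + 3,
      Zplus_leaky (graphX u v w) l = 2 * l + 2,
      Zplus_leaky (graphY u v w) l = 2 * l
    & Zplus_leaky (graphX u v w) l - Zplus_leaky (graphY u v w) l = 2].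
Proof.
have ZX := Zplus_graphX hl huv huw hvw; have ZY := Zplus_graphY hl huv huw hvw.
split=> //; last by rewrite ZX ZY addKn.
  by split; [exact: connected_graphX | exact: connected_graphY].
by have cX := card_graphX hl huv huw hvw.
Qed.
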